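(* Let $X$ be baseline covariates, $A\in\{0,1\}$ an exposure, $L\in\{0,1\}$ an exposure-induced mediator--outcome confounder with potential outcomes $L(0),L(1)\in\{0,1\}$, and $S_L\in\{0,1\}$ an observed baseline variable. Fix $a\neq a'$ in $\{0,1\}$. Suppose necessity, $P(L(b)=1\mid S_L=0,X=x)=0$ for each $b\in\{0,1\}$ and all $x$, and sufficiency under the reference treatment $a$, $P(L(a)=1\mid S_L=1,X=x)=1$ for all $x$. Then $S_L=L(a)$ and $L(a')\le L(a)$ almost surely. If moreover consistency holds ($A=b$ implies $L=L(b)$) and $\{S_L,L(a')\}\perp A\mid X$, then for all $l,l'\in\{0,1\}$, $$P(L(a)=l,\,L(a')=l'\mid X=x)=P(S_L=l,\,L=l'\mid A=a',X=x).$$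
   Context: All variables are defined on one probability space, and $\perp$ denotes (conditional) independence. Conditional statements hold almost surely wherever the conditioning event has positive conditional probability; it is assumed that $P(A=a'\mid X=x)>0$ for almost every $x$. *)

(* Defs.v *)
From HB Require Import structures.
From mathcomp Require Import all_boot all_order all_algebra.
From mathcomp Require Import all_classical all_reals all_analysis.

Set Implicit Arguments.
Unset Strict Implicit.
Unset Printing Implicit Defensive.

Import Order.TTheory GRing.Theory Num.Theory.
Import numFieldNormedType.Exports.
Local Open Scope classical_set_scope.
Local Open Scope ring_scope.

Section rv_pair.
Context d d1 d2 (T : measurableType d) (T1 : measurableType d1)
  (T2 : measurableType d2).

Definition rv_pair (Y : {mfun T >-> T1}) (Z : {mfun T >-> T2}) (w : T) :
  T1 * T2 := (Y w, Z w).

Let measurable_rv_pair (Y : {mfun T >-> T1}) (Z : {mfun T >-> T2}) :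
  measurable_fun [set: T] (rv_pair Y Z).
Proof. by apply/measurable_fun_pairP; split; exact: measurable_funP. Qed.

HB.instance Definition _ Y Z :=
  isMeasurableFun.Build _ _ _ _ (rv_pair Y Z) (measurable_rv_pair Y Z).

End rv_pair.

Section joint_measure.
Context d d' (T : measurableType d) (T' : measurableType d') (R : realType).
Variables (P : probability T R) (Z : {mfun T >-> T'}) (E : set T).
Hypothesis mE : measurable E.

Definition joint_measure := pushforward (mrestr P mE) Z.

Let joint_measure0 : joint_measure set0 = 0%E.
Proof. exact: measure0. Qed.

Let joint_measure_ge0 B : (0 <= joint_measure B)%E.
Proof. exact: measure_ge0. Qed.

Let joint_measure_sigma_additive : semi_sigma_additive joint_measure.
Proof. exact: measure_semi_sigma_additive. Qed.

HB.instance Definition _ := isMeasure.Build _ _ _ joint_measure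
  joint_measure0 joint_measure_ge0 joint_measure_sigma_additive.

Lemma joint_measureE B : joint_measure B = P (E `&` Z @^-1` B).
Proof. by rewrite /joint_measure /pushforward /mrestr setIC. Qed.

Lemma joint_measure_le B : measurable B ->
  (joint_measure B <= distribution P Z B)%E.
Proof.
move=> mB; rewrite joint_measureE /distribution /pushforward.
have mZB : measurable (Z @^-1` B) by exact: measurable_funPTI.
apply: le_measure; rewrite ?inE//; exact: measurableI.
Qed.

Let joint_measure_fin : fin_num_fun joint_measure.
Proof.
move=> B mB; rewrite ge0_fin_numE//; apply: le_lt_trans (joint_measure_le mB) _.
by rewrite -ge0_fin_numE// fin_num_measure.
Qed.

HB.instance Definition _ := Measure_isFinite.Build _ _ _ joint_measure
  joint_measure_fin.

Lemma joint_measure_dominates : joint_measure `<< distribution P Z.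
Proof.
apply/null_content_dominatesP => B mB PB0; apply/eqP.
by rewrite eq_le measure_ge0 andbT -PB0; exact: joint_measure_le.
Qed.

End joint_measure.

Section conditional_probability.
Context d d' (T : measurableType d) (T' : measurableType d') (R : realType).
Variables (P : probability T R) (Z : {mfun T >-> T'}) (E : set T).

(* [g] is a version of [z |-> P(E | Z = z)] (Kolmogorov's definition). *)
Definition cond_prob_version (g : T' -> R) : Prop :=
  (distribution P Z).-integrable [set: T'] (EFin \o g) /\
  forall B, measurable B ->
    P (E `&` Z @^-1` B) = (\int[distribution P Z]_(z in B) (g z)%:E)%E.

(* [cond_prob P Z E z] is P(E | Z = z) for an arbitrarily selected version; by
   [cond_prob_unique] it is determined up to a null set of the distribution of
   [Z], so it is to be used under an almost-everywhere quantifier. For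
   [Z = rv_pair Y X] with [Y] discrete, [cond_prob P (rv_pair Y X) E (y, x)] is
   P(E | Y = y, X = x); it is determined for almost every [x] (in the
   distribution of [X]) such that P(Y = y | X = x) > 0. *)
Definition cond_prob : T' -> R := xget (cst 0) [set g | cond_prob_version g].

Lemma cond_probP : measurable E -> cond_prob_version cond_prob.
Proof.
move=> mE.
suff [g gP] : exists g, cond_prob_version g.
  exact: (@xgetPex _ _ [set g | cond_prob_version g] (ex_intro _ g gP)).
have [g [_ gfin gint gE]] :=
  radon_nikodym_sigma_finite (@joint_measure_dominates _ _ _ _ _ P Z _ mE).
have gK : EFin \o (fine \o g) = g by apply/funext => z /=; rewrite fineK.
exists (fine \o g); split; first by rewrite gK.
move=> B mB; rewrite -(@joint_measureE _ _ _ _ _ P Z _ mE) [LHS](gE B mB).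
by apply: eq_integral => z _ /=; rewrite fineK.
Qed.

Lemma cond_prob_unique (g h : T' -> R) :
  cond_prob_version g -> cond_prob_version h ->
  {ae distribution P Z, forall z, g z = h z}.
Proof.
move=> [ig Pg] [ih Ph].
have : ae_eq (distribution P Z) [set: T'] (EFin \o g) (EFin \o h).
  apply: integral_ae_eq => //; first exact: measurable_int ih.
  by move=> B _ mB; rewrite -Pg// -Ph.
by apply: filterS => z /= /(_ I) [].
Qed.

End conditional_probability.

Section conditional_independence.
Context d d1 d2 d3 (T : measurableType d) (T1 : measurableType d1)
  (T2 : measurableType d2) (T3 : measurableType d3) (R : realType).

Definition cond_indep (P : probability T R) (Y : {mfun T >-> T1})
    (Z : {mfun T >-> T2}) (X : {mfun T >-> T3}) : Prop :=
  forall (B : set T1) (C : set T2), measurable B -> measurable C ->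
  {ae distribution P X, forall x,
    cond_prob P X (Y @^-1` B `&` Z @^-1` C) x =
    cond_prob P X (Y @^-1` B) x * cond_prob P X (Z @^-1` C) x}.

End conditional_independence.

(* Main.v *)
(** Everything rests on the identity
    P(E, Y = y | X = x) = P(E | Y = y, X = x) P(Y = y | X = x) for almost every
    x: the law of (Y, X) restricted to {Y = y} is the image, under x |-> (y, x),
    of the measure B |-> P(Y = y, X \in B), whose density with respect to the
    law of X is P(Y = y | X = x).
    Integrated over x, the identity turns necessity and sufficiency into
    P(L(b) = 1, S = 0) = 0 and P(L(a) = 1, S = 1) = P(S = 1), hence S = L(a) and
    L(a') <= L(a) almost surely. With S in place of L(a) and, on {A = a'}, with
    the observed L in place of L(a'), conditional independence and the identity
    write P(S = l, L = l', A = a' | X = x) as a product with factor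
    P(A = a' | X = x) in two ways; this factor is positive and cancels. *)

Require Import Defs.
From HB Require Import structures.
From mathcomp Require Import all_boot all_order all_algebra.
From mathcomp Require Import all_classical all_reals all_analysis.
From mathcomp Require Import measurable_realfun.

Set Implicit Arguments.
Unset Strict Implicit.
Unset Printing Implicit Defensive.

Import Order.TTheory GRing.Theory Num.Theory.
Import numFieldNormedType.Exports.
Local Open Scope classical_set_scope.
Local Open Scope ring_scope.

(** * Conditional probabilities as densities *)

Section change_of_variables.
Context d d' (T : measurableType d) (T' : measurableType d') (R : realType).
Variables (P : probability T R) (Z : {mfun T >-> T'}) (F : set T).
Hypothesis mF : measurable F.
Variable p : T' -> R.
Hypothesis pF : cond_prob_version P Z F p.

Local Notation nu := (joint_measure P Z mF).
Local Notation mu := (distribution P Z).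

Let measurable_p : measurable_fun [set: T'] (fun z => (p z)%:E).
Proof. by case: pF => /measurable_int. Qed.

Let numu : nu `<< mu.
Proof. exact: joint_measure_dominates. Qed.

(** Over every measurable [B], both functions integrate to the probability of [F] and [Z] in [B].
    Facts about the Radon-Nikodym derivative thus carry over to an arbitrary version [p]. *)
Lemma ae_eq_cond_prob_version_RN :
  ae_eq mu [set: T'] (Radon_Nikodym_SigmaFinite.f nu mu) (EFin \o p).
Proof.
case: pF => ip pE; apply: integral_ae_eq => //.
  exact: Radon_Nikodym_SigmaFinite.f_integrable.
move=> B _ mB; rewrite -Radon_Nikodym_SigmaFinite.f_integral//.
by rewrite [LHS]joint_measureE pE.
Qed.

Lemma cond_prob_version_ge0 : {ae mu, forall z, 0 <= p z}.
Proof.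
apply: filterS ae_eq_cond_prob_version_RN => z /= /(_ I) pz.
by rewrite -lee_fin -pz Radon_Nikodym_SigmaFinite.f_ge0.
Qed.

Lemma ge0_integral_joint_measure (f : T' -> \bar R) B : measurable B ->
  measurable_fun [set: T'] f -> (forall z, 0 <= f z)%E ->
  (\int[nu]_(z in B) f z = \int[mu]_(z in B) (f z * (p z)%:E))%E.
Proof.
move=> mB mf f0.
rewrite -(Radon_Nikodym_SigmaFinite.change_of_variables numu f0 mB); last first.
  exact: measurable_funTS.
apply: ae_eq_integral => //.
- apply: measurable_funTS; apply: emeasurable_funM => //.
  exact: measurable_int (Radon_Nikodym_SigmaFinite.f_integrable numu).
- by apply: measurable_funTS; exact: emeasurable_funM.
- by apply: filterS ae_eq_cond_prob_version_RN => z /= /(_ I) ->.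
Qed.

(** The nonnegative formula applied to the absolute value of [f], with [p] almost everywhere equal
    to its own absolute value. The slice argument uses both directions. *)
Lemma integrable_joint_measure (f : T' -> \bar R) :
  measurable_fun [set: T'] f ->
  nu.-integrable [set: T'] f <->
  mu.-integrable [set: T'] (fun z => f z * (p z)%:E)%E.
Proof.
move=> mf.
have -> : nu.-integrable [set: T'] f <-> (\int[nu]_z `|f z| < +oo)%E.
  by split=> [/integrableP[]//|?]; exact/integrableP.
have -> : mu.-integrable [set: T'] (fun z => f z * (p z)%:E)%E <->
    (\int[mu]_z `|f z * (p z)%:E| < +oo)%E.
  split=> [/integrableP[]//|?]; apply/integrableP; split=> //.
  exact: emeasurable_funM.
rewrite ge0_integral_joint_measure//; last exact: measurableT_comp.
rewrite (@ae_eq_integral _ _ _ _ _ (fun z => `|f z * (p z)%:E|)%E)//.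
- by apply: emeasurable_funM => //; exact: measurableT_comp.
- by apply: measurableT_comp => //; exact: emeasurable_funM.
- apply: filterS cond_prob_version_ge0 => z pz _.
  by rewrite abseM (gee0_abs (x := (p z)%:E))// lee_fin.
Qed.

Lemma integral_joint_measure (f : T' -> \bar R) B : measurable B ->
  nu.-integrable [set: T'] f ->
  (\int[nu]_(z in B) f z = \int[mu]_(z in B) (f z * (p z)%:E))%E.
Proof.
move=> mB intf.
have mf := measurable_int _ intf.
rewrite -(Radon_Nikodym_change_of_variables numu mB); last first.
  exact: integrableS intf.
apply: ae_eq_integral => //.
- by apply: measurable_funTS; apply: emeasurable_funM.
- by apply: measurable_funTS; exact: emeasurable_funM.
(* The signed change of variables is stated with the derivative of [nu] as a charge; it agrees
   almost everywhere with the sigma-finite one, hence with [p]. *)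
- apply: (@filterS2 _ _ _ _ _ _ _ ae_eq_cond_prob_version_RN
    (@ae_eq_Radon_Nikodym_SigmaFinite _ _ _ nu mu numu _ measurableT)).
  by move=> z /= /(_ I) <- /(_ I) <-.
Qed.

End change_of_variables.

(** * Conditioning on a pair with one coordinate fixed *)

Section slice.
Context d d1 d2 (T : measurableType d) (T1 : measurableType d1)
  (T2 : measurableType d2) (R : realType).
Variables (P : probability T R) (Y : {mfun T >-> T1}) (X : {mfun T >-> T2}).

(** The change of variables is used twice for the event that [Y] is [y]: its density is an indicator
    over the law of the pair, and [p] over the law of [X]. *)
Lemma cond_prob_version_slice E (y : T1) (g : T1 * T2 -> R) (p : T2 -> R) :
  measurable E -> measurable [set y] ->
  cond_prob_version P (rv_pair Y X) E g ->
  cond_prob_version P X (Y @^-1` [set y]) p ->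
  cond_prob_version P X (E `&` Y @^-1` [set y]) (fun x => g (y, x) * p x).
Proof.
move=> mE my [intg gE] pP.
have mYy : measurable (Y @^-1` [set y]) by exact: measurable_funPTI.
pose D := [set y] `*` [set: T2].
have mD : measurable D by exact: measurableX.
(* The pair determines whether [Y] is [y], so this conditional probability is an indicator. *)
have indP : cond_prob_version P (rv_pair Y X) (Y @^-1` [set y]) \1_D.
  split.
    by apply: integrable_indic => //; rewrite -ge0_fin_numE ?fin_num_measure.
  move=> B mB; rewrite integral_indic//.
  by congr (P _); apply/seteqP; split=> w [] => [|[]] /=.
have mg := measurable_int _ intg.
have mpy := @pair1_measurable _ _ T1 T2 y.
have pushE C : measurable C ->
    joint_measure P (rv_pair Y X) mYy C =
    pushforward (joint_measure P X mYy) (pair y) C.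
  move=> mC; rewrite /pushforward !joint_measureE; congr (P _).
  by apply/seteqP; split=> w /= [<-].
have intgl : (joint_measure P (rv_pair Y X) mYy).-integrable
    [set: _] (EFin \o g).
  apply/(integrable_joint_measure mYy indP mg).
  apply: le_integrable intg => //.
    apply: emeasurable_funM => //.
    by apply/measurable_EFinP; exact: measurable_indic.
  move=> z _ /=; rewrite lee_fin normrM ler_piMr// indicE.
  by case: (_ \in _); rewrite ?normr0 ?normr1.
have intgy : (joint_measure P X mYy).-integrable [set: T2]
    (fun x => (g (y, x))%:E).
  apply/integrableP; split; first exact: (measurableT_comp mg mpy).
  have -> : (\int[joint_measure P X mYy]_x `|(g (y, x))%:E| =
      \int[joint_measure P (rv_pair Y X) mYy]_z `|(g z)%:E|)%E.
    rewrite (@eq_measure_integral _ _ _ _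
      (pushforward (joint_measure P X mYy) (pair y)))//.
      rewrite [RHS]ge0_integral_pushforward//.
      exact: measurableT_comp mg.
    by move=> C mC _; exact: pushE.
  by move/integrableP : intgl => [].
split.
  exact/(proj1 (integrable_joint_measure mYy pP (measurable_int _ intgy))).
move=> B mB.
under eq_integral do rewrite EFinM.
rewrite -(integral_joint_measure pP mB intgy).
have mDB : measurable ([set y] `*` B) by exact: measurableX.
have iB : pair y @^-1` ([set y] `*` B) = B.
  by apply/seteqP; split=> x => [[]|].
transitivity (\int[joint_measure P (rv_pair Y X) mYy]_(z in [set y] `*` B)
    (g z)%:E)%E; last first.
  rewrite (@eq_measure_integral _ _ _ _
    (pushforward (joint_measure P X mYy) (pair y))); last first.
    by move=> C mC _; exact: pushE.
  rewrite [LHS]integral_pushforward// iB//.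
  exact: integrableS intgy.
rewrite (integral_joint_measure indP mDB intgl).
(* The indicator is 1 on the domain of integration, which leaves the defining property of [g]. *)
rewrite (eq_integral (EFin \o g)); last first.
  by move=> z /[!inE] -[zy _]; rewrite indicE mem_set ?mule1.
rewrite -gE//; congr (P _).
apply/seteqP; split=> w.
  by move=> [[Ew yw] Bw].
by move=> [Ew [/= yw Bw]].
Qed.

Lemma cond_prob_slice E (y : T1) : measurable E -> measurable [set y] ->
  {ae distribution P X, forall x,
    cond_prob P X (E `&` Y @^-1` [set y]) x =
    cond_prob P (rv_pair Y X) E (y, x) * cond_prob P X (Y @^-1` [set y]) x}.
Proof.
move=> mE my.
have mYy : measurable (Y @^-1` [set y]) by exact: measurable_funPTI.
apply: cond_prob_unique; first by apply: cond_probP; exact: measurableI.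
apply: cond_prob_version_slice => //; exact: cond_probP.
Qed.

End slice.

Lemma probabilityD_eq0 d (T : measurableType d) (R : realType)
    (P : probability T R) (E F : set T) : measurable E -> measurable F ->
  P (E `&` F) = P E -> P (E `\` F) = 0%E.
Proof.
move=> mE mF EF; rewrite measureD//.
  by rewrite [X in (_ - X)%E]EF subee// fin_num_measure.
by rewrite -ge0_fin_numE ?fin_num_measure.
Qed.

(** * Events and their conditional probabilities up to null sets *)

Section ae_equal_events.
Context d d' (T : measurableType d) (T' : measurableType d') (R : realType).
Variables (P : probability T R) (Z : {mfun T >-> T'}).

Lemma measure_ae_iff (E F : set T) : measurable E -> measurable F ->
  {ae P, forall w, E w <-> F w} -> P E = P F.
Proof.
move=> mE mF EF.
have PE G : measurable G -> P G = (\int[P]_w (\1_G w)%:E)%E.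
  by move=> mG; rewrite integral_indic// setIT.
rewrite PE// PE//; apply: ae_eq_integral => //.
- by apply/measurable_EFinP; exact: measurable_indic.
- by apply/measurable_EFinP; exact: measurable_indic.
- apply: filterS EF => w EF _; rewrite !indicE.
  by congr ((nat_of_bool _)%:R%:E); apply/idP/idP => /set_mem/EF/mem_set.
Qed.

(** Any version for [F] is also a version for [E], and versions are almost everywhere unique. *)
Lemma ae_eq_cond_prob (E F : set T) : measurable E -> measurable F ->
  {ae P, forall w, E w <-> F w} ->
  {ae distribution P Z, forall z, cond_prob P Z E z = cond_prob P Z F z}.
Proof.
move=> mE mF EF; apply: (@cond_prob_unique _ _ _ _ _ P Z E).
  exact: cond_probP.
have [intF FE] := cond_probP P Z mF; split=> // B mB; rewrite -FE//.
have mZB : measurable (Z @^-1` B) by exact: measurable_funPTI.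
apply: measure_ae_iff; [exact: measurableI..|].
by apply: filterS EF => w EF; split=> -[/EF].
Qed.

Lemma probability_cond_prob (E : set T) : measurable E ->
  P E = (\int[distribution P Z]_z (cond_prob P Z E z)%:E)%E.
Proof.
by move=> mE; have [_ <-] := cond_probP P Z mE; rewrite // preimage_setT setIT.
Qed.

Lemma eq_probability_cond_prob (E F : set T) : measurable E -> measurable F ->
  {ae distribution P Z, forall z, cond_prob P Z E z = cond_prob P Z F z} ->
  P E = P F.
Proof.
move=> mE mF EF; rewrite !probability_cond_prob//.
have [/measurable_int ? _] := cond_probP P Z mE.
have [/measurable_int ? _] := cond_probP P Z mF.
by apply: ae_eq_integral => //; apply: filterS EF => z -> _.
Qed.

Lemma cond_prob_eq0 (E : set T) : measurable E ->
  {ae distribution P Z, forall z, cond_prob P Z E z = 0} -> P E = 0%E.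
Proof.
move=> mE E0; rewrite probability_cond_prob//.
have [/measurable_int ? _] := cond_probP P Z mE.
rewrite (ae_eq_integral (cst 0%E)) ?integral0//.
by apply: filterS E0 => z -> _.
Qed.

End ae_equal_events.

Unset Implicit Arguments.

Theorem mainTheorem9 (d dX : measure_display) (T : measurableType d)
    (TX : measurableType dX) (R : realType) (P : probability T R)
    (X : {RV P >-> TX}) (A Lobs S : {RV P >-> bool})
    (L : bool -> {RV P >-> bool}) (a a' : bool)
    (positivity : {ae distribution P X, forall x,
       0 < cond_prob P X [set w | A w = a'] x})
    (aa' : a <> a')
    (necessity : forall b : bool, {ae distribution P X, forall x,
       0 < cond_prob P X [set w | S w = false] x ->
       cond_prob P (rv_pair S X) [set w | L b w = true] (false, x) = 0})
    (sufficiency : {ae distribution P X, forall x,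
       0 < cond_prob P X [set w | S w = true] x ->
       cond_prob P (rv_pair S X) [set w | L a w = true] (true, x) = 1}) :
  {ae P, forall w, S w = L a w /\ (L a' w <= L a w)%N} /\
  ({ae P, forall w, forall b : bool, A w = b -> Lobs w = L b w} ->
   cond_indep P (rv_pair S (L a')) A X ->
   forall l l' : bool, {ae distribution P X, forall x,
     cond_prob P X [set w | L a w = l /\ L a' w = l'] x =
     cond_prob P (rv_pair A X) [set w | S w = l /\ Lobs w = l'] (a', x)}).
Proof.
have mE (Y : {RV P >-> bool}) b : measurable [set w | Y w = b].
  by rewrite -[X in measurable X]/(Y @^-1` [set b]); exact: measurable_funPTI.
have ge0 E : measurable E ->
    {ae distribution P X, forall x, 0 <= cond_prob P X E x}.
  by move=> mE'; apply: (cond_prob_version_ge0 mE'); exact: cond_probP.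
have ae0 N : measurable N -> P N = 0%E -> {ae P, forall w, ~ N w}.
  by move=> mN N0; exists N; split=> // w; exact: contrapT.
have LS (b : bool) : {ae P, forall w, ~ (L b w = true /\ S w = false)}.
  have mLS := measurableI _ _ (mE (L b) true) (mE S false).
  apply: (ae0 _ mLS); apply: (@cond_prob_eq0 _ _ _ _ _ P X _ mLS).
  (* Every set of booleans is measurable by definition, so [I] proves it for the singleton. *)
  have sl := cond_prob_slice P S X (mE (L b) true) (y := false) I.
  apply: filterS3 sl (necessity b) (ge0 _ (mE S false)) => x -> nec.
  (* Necessity speaks only of [x] at which [S = false] has positive conditional probability;
     elsewhere that factor is 0 and the product vanishes anyway. *)
  by rewrite le_eqVlt => /predU1P[<-|/nec ->]; rewrite ?mulr0 ?mul0r.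
have SL : {ae P, forall w, ~ (S w = true /\ ~ (L a w = true))}.
  have mSL := measurableI _ _ (mE (L a) true) (mE S true).
  have mSD := measurableD (mE S true) (mE (L a) true).
  apply: (ae0 _ mSD).
  apply: (probabilityD_eq0 (mE S true) (mE (L a) true)).
  rewrite setIC.
  apply: (@eq_probability_cond_prob _ _ _ _ _ P X _ _ mSL (mE S true)).
  have sl := cond_prob_slice P S X (mE (L a) true) (y := true) I.
  apply: filterS3 sl sufficiency (ge0 _ (mE S true)) => x -> suf.
  by rewrite le_eqVlt => /predU1P[<-|/suf ->]; rewrite ?mulr0 ?mul1r.
have SLa : {ae P, forall w, S w = L a w}.
  apply: filterS2 (LS a) SL => w.
  by case: (S w); case: (L a w) => // H K; exfalso; [apply: K|apply: H].
split.
  apply: filterS2 SLa (LS a') => w SLw b; split=> //; rewrite -SLw.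
  (* The inequality fails only if [L a' w] is true and [S w] false, which [LS a'] excludes. *)
  by case: (L a' w) b; case: (S w) => // -[].
move=> cons indep l l'.
have mE2 (Y Y' : {RV P >-> bool}) b b' :
    measurable [set w | Y w = b /\ Y' w = b'].
  exact: measurableI (mE Y b) (mE Y' b').
have SLE : {ae distribution P X, forall x,
    cond_prob P X [set w | L a w = l /\ L a' w = l'] x =
    cond_prob P X [set w | S w = l /\ L a' w = l'] x}.
  by apply: ae_eq_cond_prob => //; apply: filterS SLa => w /= ->.
have obsE : {ae distribution P X, forall x,
    cond_prob P X ([set w | S w = l /\ L a' w = l'] `&` [set w | A w = a']) x =
    cond_prob P X ([set w | S w = l /\ Lobs w = l'] `&` [set w | A w = a']) x}.
  apply: ae_eq_cond_prob; [exact: measurableI..|].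
  (* Both events lie in [A = a'], so consistency is applied at [a'] alone. *)
  apply: filterS cons => w /= /(_ a') ALw.
  by split=> -[[Sl <-] Aw]; rewrite ALw.
have sl := cond_prob_slice P A X (mE2 S Lobs l l') (y := a') I.
have mll : measurable ([set l] `*` [set l']) by exact: measurableX.
have ind := indep _ [set a'] mll I.
have pairE : rv_pair S (L a') @^-1` ([set l] `*` [set l']) =
    [set w | S w = l /\ L a' w = l'] by [].
rewrite pairE in ind.
apply: filterS3 SLE obsE (filterI ind (filterI sl positivity)) => x ->.
move=> obs [ind' [sl' pos]]; apply: (mulIf (lt0r_neq0 pos)).
by rewrite -[LHS]ind' -[RHS]sl' -obs.
Qed.
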